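(* Let $G$ be a group that is not virtually abelian and such that $\mathrm{Comm}(G)$ does not contain subgroups isomorphic to $(\mathbb{Z}/2\mathbb{Z})^k$ for arbitrarily large $k$. Then $G$ is not abstractly commensurable with a right-angled Artin group.
   Context: A group is virtually abelian if it has an abelian subgroup of finite index. The abstract commensurator $\mathrm{Comm}(G)$ of a group $G$ is the group of all isomorphisms between finite-index subgroups of $G$, up to restriction: two such isomorphisms are identified if they agree on some finite-index subgroup of $G$, and the product is composition on a finite-index subgroup where it is defined. Two groups are abstractly commensurable if they have isomorphic finite-index subgroups. To a finite (simplicial) graph $\Gamma$ one associates a right-angled Artin group: the group with one generator for each vertex of $\Gamma$ and one defining relator for each edge, namely the commutator of the two generators corresponding to the endpoints of the edge. *)

(* Defs.v *)
From HB Require Import structures.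
From mathcomp Require Import all_boot all_algebra all_fingroup.
From mathcomp Require Import generic_quotient.
From mathcomp Require Import boolp classical_sets functions cardinality.

Set Implicit Arguments.
Unset Strict Implicit.
Unset Printing Implicit Defensive.

Local Open Scope classical_set_scope.
Local Open Scope quotient_scope.
Local Open Scope group_scope.

(* Subgroups of a possibly infinite group [G : groupType] are the elements of *)
(* [groupClosed G].  Boolean membership is no restriction, since all          *)
(* predicates are decidable under the classical axioms of [boolp].            *)

Section Subgroups.
Implicit Types G A : groupType.

Definition mk_subgroup G (S : {pred G}) (SP : group_closed S) : groupClosed G :=
  HB.pack S (isInvClosed.Build G S (group_closedV SP))
            (isMul1Closed.Build G S SP.1)
            (isMulClosed.Build G S (group_closedM SP)).

Definition left_coset G (H : {pred G}) (x : G) : set G :=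
  [set y | x^-1 * y \in H].

Definition finite_index G (H : {pred G}) : Prop :=
  finite_set (range (left_coset H)).

Definition virtually_abelian G : Prop :=
  exists H : groupClosed G, finite_index H /\ {in H &, forall x y, commute x y}.

(* [f] restricts to a group isomorphism from [H] onto [K]; its values outside *)
(* [H] are irrelevant.                                                        *)
Definition subgroup_iso G A (H : {pred G}) (K : {pred A}) (f : G -> A) : Prop :=
  {in H &, {morph f : x y / x * y}} /\ set_bij [set` H] [set` K] f.

Definition abstractly_commensurable G A : Prop :=
  exists (H : groupClosed G) (K : groupClosed A),
    [/\ finite_index H, finite_index K & exists f, subgroup_iso H K f].

Definition contains_copy_of A G : Prop :=
  exists (K : groupClosed G) (f : A -> G), subgroup_iso predT K f.

(* (Z/2Z)^k: the group law of ['Z_2] is addition, and that of [{ffun _ -> _}] *)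
(* is pointwise.                                                              *)
Definition Z2_pow (k : nat) : groupType := {ffun 'I_k -> 'Z_2}.

End Subgroups.

Section SubgroupFacts.
Implicit Types G A : groupType.

Lemma left_cosetxx G (H : groupClosed G) x : left_coset H x x.
Proof. by rewrite /left_coset /= mulVg gpred1. Qed.

Lemma finite_index_inv G (H : groupClosed G) (T : Type) (c : G -> T) :
  finite_set (range c) -> (forall x y, c x = c y -> x^-1 * y \in H) ->
  finite_index H.
Proof.
move=> cfin cH; pose D t := left_coset H (xget 1 [set x | c x = t]).
apply: (@sub_finite_set _ _ (D @` range c)); last exact: finite_image.
move=> _ [x _ <-]; exists (c x); first by exists x.
rewrite /D; case: xgetP => [z _ /= czx|/(_ x)/= //].
have zx := cH _ _ czx; apply/seteqP; split=> y /= yH; rewrite /left_coset /=.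
  have -> : x^-1 * y = (z^-1 * x)^-1 * (z^-1 * y).
    by rewrite invgM invgK -!mulgA mulKVg.
  by apply: gpredM => //; rewrite gpredV.
have -> : z^-1 * y = (z^-1 * x) * (x^-1 * y) by rewrite -!mulgA mulKVg.
exact: gpredM.
Qed.

Lemma left_coset_eq G (H : groupClosed G) x y :
  left_coset H x = left_coset H y -> x^-1 * y \in H.
Proof. by move=> e; have := left_cosetxx H y; rewrite -e. Qed.

Lemma finite_indexT G : @finite_index G predT.
Proof.
apply: (@sub_finite_set _ _ [set setT]); last exact: finite_set1.
by move=> _ [x _ <-]; apply/seteqP; split.
Qed.

Section Morph.
Variables (G A : groupType) (H : groupClosed G) (f : G -> A).
Hypothesis fM : {in H &, {morph f : x y / x * y}}.

Lemma morph_in1 : f 1 = 1.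
Proof.
have h1 : 1 \in H by exact: gpred1.
have /(congr1 (fun z => (f 1)^-1 * z)) := fM h1 h1.
by rewrite mulg1 mulKg mulVg.
Qed.

Lemma morph_inV : {in H, {morph f : x / x^-1}}.
Proof.
move=> x xH; have xH' : x^-1 \in H by rewrite gpredV.
apply: (mulgI (f x)); by rewrite -fM // !mulgV morph_in1.
Qed.

Variable K : groupClosed A.

Fact morph_preim_closed : group_closed [pred x | (x \in H) && (f x \in K)].
Proof.
split; first by rewrite inE gpred1 morph_in1 gpred1.
move=> x y /andP[xH xK] /andP[yH yK]; have yH' : y^-1 \in H by rewrite gpredV.
by rewrite inE gpredM // fM // morph_inV // gpredM // gpredV.
Qed.

Definition morph_preim : groupClosed G := mk_subgroup morph_preim_closed.

Lemma morph_preimP x : (x \in morph_preim) = (x \in H) && (f x \in K).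
Proof. by []. Qed.

Lemma finite_index_preim :
  finite_index H -> finite_index K -> finite_index morph_preim.
Proof.
move=> Hfi Kfi.
pose r (C : set G) := xget 1 C.
have rP x : (r (left_coset H x))^-1 * x \in H.
  rewrite /r; case: xgetP => [z _|/(_ _ (left_cosetxx H x)) //].
  rewrite /left_coset /= => zH; have : (x^-1 * z)^-1 \in H by rewrite gpredV.
  by rewrite invgM invgK.
pose c x := (left_coset H x,
             left_coset K (f ((r (left_coset H x))^-1 * x))).
apply: (finite_index_inv (c := c)).
  apply: (@sub_finite_set _ _ (range (left_coset H) `*` range (left_coset K))).
    by move=> _ [x _ <-]; split=> /=; eexists.
  exact: finite_setX.
move=> x y [eH eK]; have xyH := left_coset_eq eH.
rewrite morph_preimP xyH /=; have {eK} := left_coset_eq eK.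
have := rP y; rewrite -eH; have := rP x; set z := r _ => zx zy.
rewrite -morph_inV // -fM ?gpredV //.
by rewrite invgM invgK -mulgA mulKVg.
Qed.

End Morph.

Lemma subgroup_iso_inv G A (H : groupClosed G) (K : groupClosed A) f :
  subgroup_iso H K f -> subgroup_iso K H ('pinv_(fun=> 1) [set` H] f).
Proof.
move=> [fM fb]; have gb := bijpinv_bij (fun=> 1) fb; split=> //.
have gK x : x \in H -> 'pinv_(fun=> 1) [set` H] f (f x) = x.
  by move=> xH; apply: pinvKV; [exact: set_bij_inj fb|rewrite inE].
have [_ _ fs] := fb.
move=> x y xK yK; have [a /= aH <-] := fs x xK; have [b /= bH <-] := fs y yK.
by rewrite -fM // !gK // gpredM.
Qed.

End SubgroupFacts.

Section AbstractCommensurator.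
Variable G : groupType.

Record partial_auto := PartialAuto {
  pa_dom : groupClosed G;
  pa_cod : groupClosed G;
  pa_fun :> G -> G;
  pa_dom_fi : finite_index pa_dom;
  pa_cod_fi : finite_index pa_cod;
  pa_iso : subgroup_iso pa_dom pa_cod pa_fun }.

HB.instance Definition _ := gen_eqMixin partial_auto.
HB.instance Definition _ := gen_choiceMixin partial_auto.

(* Two isomorphisms between finite-index subgroups are identified in [Comm]   *)
(* when they agree on some finite-index subgroup.                             *)
Definition agree_fi (f g : partial_auto) : Prop :=
  exists K : groupClosed G,
    [/\ finite_index K, {subset K <= pa_dom f}, {subset K <= pa_dom g}
      & {in K, f =1 g}].

Lemma pa_morph (f : partial_auto) :
  {in pa_dom f &, {morph f : x y / x * y}}.
Proof. by case: (pa_iso f). Qed.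

Lemma pa_codP (f : partial_auto) x : x \in pa_dom f -> f x \in pa_cod f.
Proof. by case: (pa_iso f) => _ [+ _ _] xf; apply. Qed.

Definition pa_inv (f : partial_auto) : partial_auto :=
  PartialAuto (pa_cod_fi f) (pa_dom_fi f) (subgroup_iso_inv (pa_iso f)).

Lemma pa_invK (f : partial_auto) x : x \in pa_dom f -> pa_inv f (f x) = x.
Proof.
case: (pa_iso f) => _ fb xf; apply: pinvKV; first exact: set_bij_inj fb.
by rewrite inE.
Qed.

Lemma pa_invKV (f : partial_auto) x : x \in pa_cod f -> f (pa_inv f x) = x.
Proof.
move=> xf; have [_ [_ _ fs]] := pa_iso f; have [y yf <-] := fs _ xf.
by rewrite pa_invK.
Qed.

Section Comp.
Variables f g : partial_auto.

Definition pa_comp_dom := morph_preim (@pa_morph g) (pa_dom f).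
Definition pa_comp_cod := morph_preim (@pa_morph (pa_inv f)) (pa_cod g).

Lemma pa_comp_domP x :
  (x \in pa_comp_dom) = (x \in pa_dom g) && (g x \in pa_dom f).
Proof. by []. Qed.

Lemma pa_comp_codP x :
  (x \in pa_comp_cod) = (x \in pa_cod f) && (pa_inv f x \in pa_cod g).
Proof. by []. Qed.

Fact pa_comp_iso : subgroup_iso pa_comp_dom pa_comp_cod (f \o g).
Proof.
split.
  move=> x y; rewrite !pa_comp_domP => /andP[xg xf] /andP[yg yf].
  by rewrite /comp !pa_morph.
split.
- move=> x; rewrite /mkset pa_comp_domP pa_comp_codP /comp => /andP[xg xf].
  by rewrite pa_codP // pa_invK // pa_codP.
- move=> x y /set_mem; rewrite /mkset pa_comp_domP => /andP[xg xf].
  move=> /set_mem; rewrite /mkset pa_comp_domP => /andP[yg yf].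
  move=> /(congr1 (pa_inv f)); rewrite /comp !pa_invK //.
  by move=> /(congr1 (pa_inv g)); rewrite !pa_invK.
- move=> z; rewrite /mkset pa_comp_codP => /andP[zf zg].
  have zf' : pa_inv f z \in pa_dom f := @pa_codP (pa_inv f) _ zf.
  have zg' : pa_inv g (pa_inv f z) \in pa_dom g := @pa_codP (pa_inv g) _ zg.
  exists (pa_inv g (pa_inv f z)); last by rewrite /comp !pa_invKV.
  by rewrite /mkset pa_comp_domP zg' pa_invKV.
Qed.

Definition pa_comp : partial_auto :=
  PartialAuto
    (finite_index_preim (@pa_morph g) (pa_dom_fi g) (pa_dom_fi f))
    (finite_index_preim (@pa_morph (pa_inv f)) (pa_cod_fi f) (pa_cod_fi g))
    pa_comp_iso.

End Comp.

Lemma pa_dom_comp f g x :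
  (x \in pa_dom (pa_comp f g)) = (x \in pa_dom g) && (g x \in pa_dom f).
Proof. by []. Qed.

Definition full_subgroup : groupClosed G :=
  @mk_subgroup G predT (conj isT (fun _ _ _ _ => isT)).

Fact pa_id_iso : subgroup_iso full_subgroup full_subgroup id.
Proof. by split=> //; split=> // x _; exists x. Qed.

Definition pa_id : partial_auto :=
  @PartialAuto full_subgroup full_subgroup id
    (@finite_indexT G) (@finite_indexT G) pa_id_iso.

Lemma agree_fi_refl f : agree_fi f f.
Proof. by exists (pa_dom f); split=> //; exact: pa_dom_fi. Qed.

Lemma agree_fi_sym f g : agree_fi f g -> agree_fi g f.
Proof. by move=> [K [Kfi Kf Kg e]]; exists K; split=> // x /e. Qed.

Lemma agree_fi_trans g f h : agree_fi f g -> agree_fi g h -> agree_fi f h.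
Proof.
move=> [K [Kfi Kf Kg e]] [L [Lfi Lg Lh e']].
have idM : {in K &, {morph id : x y / x * y}} by [].
exists (morph_preim idM L); split; first exact: finite_index_preim.
- by move=> x /andP[/Kf].
- by move=> x /andP[_ /Lh].
- by move=> x /andP[/= xK xL]; rewrite e // e'.
Qed.

Definition agree_fib (f g : partial_auto) : bool := `[< agree_fi f g >].

Fact agree_fib_refl : reflexive agree_fib.
Proof. by move=> f; apply/asboolP; exact: agree_fi_refl. Qed.

Fact agree_fib_sym : symmetric agree_fib.
Proof. by move=> f g; apply/asboolP/asboolP; exact: agree_fi_sym. Qed.

Fact agree_fib_trans : transitive agree_fib.
Proof.
move=> g f h /asboolP fg /asboolP gh; apply/asboolP.
exact: agree_fi_trans fg gh.
Qed.

Canonical agree_fi_equiv :=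
  EquivRel agree_fib agree_fib_refl agree_fib_sym agree_fib_trans.

Definition Comm : Type := {eq_quot agree_fib}.

HB.instance Definition _ := Choice.on Comm.
HB.instance Definition _ := EqQuotient.on Comm.

Lemma CommP f g : agree_fi f g <-> \pi_Comm f = \pi_Comm g.
Proof.
by split=> [fg|/eqmodP/asboolP//]; apply/eqmodP/asboolP.
Qed.

Lemma agree_fi_comp f f' g g' :
  agree_fi f f' -> agree_fi g g' -> agree_fi (pa_comp f g) (pa_comp f' g').
Proof.
move=> [K [Kfi Kf Kf' e]] [L [Lfi Lg Lg' e']].
have gM : {in L &, {morph g : x y / x * y}}.
  by move=> x y /Lg xg /Lg; exact: pa_morph.
exists (morph_preim gM K); split; first exact: finite_index_preim.
- by move=> x /andP[/Lg xg /Kf gxf]; rewrite pa_dom_comp xg.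
- move=> x /andP[xL gxK]; rewrite pa_dom_comp Lg' // -e' //.
  exact: Kf'.
- by move=> x /andP[xL gxK]; rewrite /= -e' // e.
Qed.

Lemma agree_fi_inv f g : agree_fi f g -> agree_fi (pa_inv f) (pa_inv g).
Proof.
move=> [K [Kfi Kf Kg e]].
exists (morph_preim (@pa_morph (pa_inv f)) K); split.
- exact: finite_index_preim (pa_cod_fi f) Kfi.
- by move=> x /andP[].
- move=> x /andP[/= xf xK]; rewrite -(pa_invKV xf) e //.
  by apply: pa_codP; exact: Kg.
- move=> x /andP[/= xf xK]; rewrite -[in RHS](pa_invKV xf) e //.
  by rewrite [RHS]pa_invK //; exact: Kg.
Qed.

(* The product is composition, applied right to left. *)
Definition Comm_mul (a b : Comm) : Comm := \pi_Comm (pa_comp (repr a) (repr b)).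
Definition Comm_inv (a : Comm) : Comm := \pi_Comm (pa_inv (repr a)).
Definition Comm_one : Comm := \pi_Comm pa_id.

Lemma agree_fi_repr f : agree_fi (repr (\pi_Comm f)) f.
Proof. by apply/CommP; rewrite reprK. Qed.

Lemma Comm_mulE f g :
  Comm_mul (\pi_Comm f) (\pi_Comm g) = \pi_Comm (pa_comp f g).
Proof. by apply/CommP/agree_fi_comp; exact: agree_fi_repr. Qed.

Lemma Comm_invE f : Comm_inv (\pi_Comm f) = \pi_Comm (pa_inv f).
Proof. by apply/CommP/agree_fi_inv; exact: agree_fi_repr. Qed.

Lemma agree_fi_dom f g : {subset pa_dom f <= pa_dom g} ->
  {in pa_dom f, f =1 g} -> agree_fi f g.
Proof. by move=> fg e; exists (pa_dom f); split=> //; exact: pa_dom_fi. Qed.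

Fact Comm_mulA : associative Comm_mul.
Proof.
elim/quotW=> f; elim/quotW=> g; elim/quotW=> h.
rewrite (Comm_mulE g h) (Comm_mulE f g) (Comm_mulE f) (Comm_mulE _ h).
apply/CommP/agree_fi_dom => // x; rewrite !pa_dom_comp.
by case/andP=> /andP[-> ->] ->.
Qed.

Fact Comm_mul1 : left_id Comm_one Comm_mul.
Proof.
by elim/quotW=> f; rewrite Comm_mulE; apply/CommP/agree_fi_dom => // x /andP[].
Qed.

Fact Comm_1mul : right_id Comm_one Comm_mul.
Proof.
by elim/quotW=> f; rewrite Comm_mulE; apply/CommP/agree_fi_dom => // x /andP[].
Qed.

Fact Comm_mulV : left_inverse Comm_one Comm_inv Comm_mul.
Proof.
elim/quotW=> f; rewrite Comm_invE Comm_mulE.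
by apply/CommP/agree_fi_dom => // x /andP[/= xf _]; rewrite [LHS]pa_invK.
Qed.

Fact Comm_Vmul : right_inverse Comm_one Comm_inv Comm_mul.
Proof.
elim/quotW=> f; rewrite Comm_invE Comm_mulE.
by apply/CommP/agree_fi_dom => // x /andP[/= xf _]; rewrite [LHS]pa_invKV.
Qed.

HB.instance Definition _ :=
  isGroup.Build Comm Comm_mulA Comm_mul1 Comm_1mul Comm_mulV Comm_Vmul.

End AbstractCommensurator.

Section Presentation.
Variable T : choiceType.

(* The letter [(x, false)] stands for the generator [x], the letter           *)
(* [(x, true)] for its inverse.                                               *)
Definition word := seq (T * bool).

Definition word_inv (w : word) : word := rev [seq (a.1, ~~ a.2) | a <- w].

Definition word_comm (u v : T) : word :=
  [:: (u, true); (v, true); (u, false); (v, false)].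

Variable R : set word.

Inductive pres_eq : word -> word -> Prop :=
| pres_refl w : pres_eq w w
| pres_sym w1 w2 : pres_eq w1 w2 -> pres_eq w2 w1
| pres_trans w2 w1 w3 : pres_eq w1 w2 -> pres_eq w2 w3 -> pres_eq w1 w3
| pres_cat w1 w1' w2 w2' :
    pres_eq w1 w1' -> pres_eq w2 w2' -> pres_eq (w1 ++ w2) (w1' ++ w2')
| pres_cancel x b : pres_eq [:: (x, b); (x, ~~ b)] [::]
| pres_rel r : R r -> pres_eq r [::].

Definition pres_eqb (w1 w2 : word) : bool := `[< pres_eq w1 w2 >].

Fact pres_eqb_refl : reflexive pres_eqb.
Proof. by move=> w; apply/asboolP; exact: pres_refl. Qed.

Fact pres_eqb_sym : symmetric pres_eqb.
Proof. by move=> w1 w2; apply/asboolP/asboolP; exact: pres_sym. Qed.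

Fact pres_eqb_trans : transitive pres_eqb.
Proof.
by move=> w2 w1 w3 /asboolP h /asboolP h'; apply/asboolP; exact: pres_trans h'.
Qed.

Canonical pres_equiv :=
  EquivRel pres_eqb pres_eqb_refl pres_eqb_sym pres_eqb_trans.

(* The group with presentation < T | R >. *)
Definition presented_group : Type := {eq_quot pres_eqb}.

HB.instance Definition _ := Choice.on presented_group.
HB.instance Definition _ := EqQuotient.on presented_group.

Lemma presentedP w1 w2 :
  pres_eq w1 w2 <-> \pi_presented_group w1 = \pi_presented_group w2.
Proof. by split=> [h|/eqmodP/asboolP//]; apply/eqmodP/asboolP. Qed.

Lemma word_invK : involutive word_inv.
Proof.
move=> w; rewrite /word_inv map_rev revK -map_comp map_id_in // => -[x b] _ /=.
by rewrite negbK.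
Qed.

Lemma word_inv_cat w1 w2 : word_inv (w1 ++ w2) = word_inv w2 ++ word_inv w1.
Proof. by rewrite /word_inv map_cat rev_cat. Qed.

Lemma word_inv_cons a w : word_inv (a :: w) = word_inv w ++ [:: (a.1, ~~ a.2)].
Proof. by rewrite -cat1s word_inv_cat. Qed.

Lemma pres_mulV w : pres_eq (w ++ word_inv w) [::].
Proof.
elim: w => [|[x b] w IH]; first exact: pres_refl.
rewrite word_inv_cons -cat1s -catA (catA w).
apply: pres_trans (pres_cancel x b).
rewrite -[X in pres_eq _ X]/([:: (x, b)] ++ ([::] ++ [:: (x, ~~ b)])).
apply: pres_cat (pres_refl _) _; exact: pres_cat (pres_refl _).
Qed.

Lemma pres_Vmul w : pres_eq (word_inv w ++ w) [::].
Proof. by have := pres_mulV (word_inv w); rewrite word_invK. Qed.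

Lemma pres_inv w1 w2 : pres_eq w1 w2 -> pres_eq (word_inv w1) (word_inv w2).
Proof.
move=> h; apply: (@pres_trans (word_inv w1 ++ (w2 ++ word_inv w2))).
  rewrite -[X in pres_eq X _]cats0; apply: pres_cat (pres_refl _) _.
  exact/pres_sym/pres_mulV.
rewrite catA -[X in pres_eq _ X]cat0s; apply: pres_cat (pres_refl _).
apply: pres_trans (pres_Vmul w1); apply: pres_cat (pres_refl _) _.
exact: pres_sym.
Qed.

Definition pres_mul (a b : presented_group) : presented_group :=
  \pi_presented_group (repr a ++ repr b).
Definition pres_invg (a : presented_group) : presented_group :=
  \pi_presented_group (word_inv (repr a)).
Definition pres_one : presented_group := \pi_presented_group [::].

Lemma pres_eq_repr w : pres_eq (repr (\pi_presented_group w)) w.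
Proof. by apply/presentedP; rewrite reprK. Qed.

Lemma pres_mulE w1 w2 :
  pres_mul (\pi_presented_group w1) (\pi_presented_group w2)
  = \pi_presented_group (w1 ++ w2).
Proof. by apply/presentedP/pres_cat; exact: pres_eq_repr. Qed.

Lemma pres_invE w :
  pres_invg (\pi_presented_group w) = \pi_presented_group (word_inv w).
Proof. by apply/presentedP/pres_inv; exact: pres_eq_repr. Qed.

Fact pres_mulgA : associative pres_mul.
Proof.
elim/quotW=> a; elim/quotW=> b; elim/quotW=> c.
by rewrite (pres_mulE b c) (pres_mulE a b) (pres_mulE a) (pres_mulE _ c) catA.
Qed.

Fact pres_mul1g : left_id pres_one pres_mul.
Proof. by elim/quotW=> a; rewrite pres_mulE. Qed.

Fact pres_mulg1 : right_id pres_one pres_mul.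
Proof. by elim/quotW=> a; rewrite pres_mulE cats0. Qed.

Fact pres_mulVg : left_inverse pres_one pres_invg pres_mul.
Proof.
by elim/quotW=> a; rewrite pres_invE pres_mulE; apply/presentedP/pres_Vmul.
Qed.

Fact pres_mulgV : right_inverse pres_one pres_invg pres_mul.
Proof.
by elim/quotW=> a; rewrite pres_invE pres_mulE; apply/presentedP/pres_mulV.
Qed.

HB.instance Definition _ := isGroup.Build presented_group
  pres_mulgA pres_mul1g pres_mulg1 pres_mulVg pres_mulgV.

End Presentation.

(* The right-angled Artin group of the graph on [V] with adjacency relation   *)
(* [e].  Each edge contributes the commutators of both of its orientations;   *)
(* these are inverse to each other, so this is one relator per edge.          *)
Definition raag (V : finType) (e : rel V) : groupType :=
  presented_group [set r | exists u v : V, e u v /\ r = word_comm u v].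

(* Main.v *)
Require Import Defs.
From mathcomp Require Import all_boot all_algebra all_fingroup.
From mathcomp Require Import generic_quotient.
From mathcomp Require Import boolp classical_sets functions cardinality.

(** If any two distinct vertices are adjacent, the right-angled Artin group is
abelian and a group commensurable with it is virtually abelian.  Otherwise fix
distinct non-adjacent vertices [u] and [v], and an integer [n >= 2].  The
exponent sum of [u] modulo [n], the height, is a homomorphism to Z/n; let [K]
be its kernel.  Conceptually, [K] is again a right-angled Artin group, among
whose standard generators are the [n] conjugates [u^j v u^-j], and inverting
these conjugates independently of each other gives an action of (Z/2)^n.

No presentation of [K] is needed to define this action.  For a set [s] of
residues modulo [n], replace in a word each letter [v] or [v^-1] by its inverse
whenever the height of the prefix before it lies in [s] ([twist]).  Since [v]
does not change the height and no relator involves both [u] and [v], this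
operation respects the relations of the Artin group ([twist_raag]); it is
multiplicative up to a shift of the starting height ([raag_twistM]), hence
multiplicative on [K].  Twists compose by symmetric difference of the sets
([twist_comp]), so (Z/2)^n acts on [K] ([sign_act_virtual]).  The twist by [s]
sends [u^j v u^-j] to its inverse for [j] in [s]; as powers of this element
meet every subgroup of finite index and are detected by the exponent sum of
[v], a nontrivial element of (Z/2)^n never agrees with the identity on a
subgroup of finite index ([sign_act_faithful]).

Such an action of a finite group on a finite-index subgroup can be moved to any
commensurable group ([virtual_action_transport]) and embeds the finite group
into the abstract commensurator ([Comm_contains_virtual_action]).  As [n] is
arbitrary, the commensurator contains arbitrarily large powers of Z/2. *)

(** * Groups acting on finite-index subgroups *)

Section VirtualActions.
Local Open Scope group_scope.
Local Open Scope classical_set_scope.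
Local Open Scope quotient_scope.

(** The values [act b x] for [x] outside of [M] are irrelevant. *)
Definition virtual_action {B G : groupType} (M : groupClosed G)
    (act : B -> G -> G) : Prop :=
  [/\ finite_index M,
      forall b, {in M, forall x, act b x \in M},
      forall b, {in M &, {morph act b : x y / x * y}},
      {in M, act 1 =1 id} &
      forall b c, {in M, act (b * c) =1 act b \o act c}].

(** Restricting the action to a smaller subgroup of finite index never creates
a kernel; this is what makes the map to the commensurator injective. *)
Definition virtually_faithful {B G : groupType} (M : groupClosed G)
    (act : B -> G -> G) : Prop :=
  forall (b : B) (N : groupClosed G), b != 1 -> finite_index N ->
  exists x, [/\ x \in M, x \in N & act b x != x].

Lemma virtual_action_iso {B G : groupType} {M : groupClosed G}
    {act : B -> G -> G} (b : B) :
  virtual_action M act -> subgroup_iso M M (act b).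
Proof.
move=> [_ aM aH a1 aC]; split; first exact: aH.
have aK c x : x \in M -> act c^-1 (act c x) = x.
  by move=> xM; rewrite -[LHS]/((act c^-1 \o act c) x) -aC // mulVg a1.
split.
- by move=> x /= xM; exact: aM.
- by move=> x y /set_mem xM /set_mem yM exy; rewrite -(aK b x) // exy aK.
- move=> x /= xM; exists (act b^-1 x) => /=; first exact: aM.
  by rewrite -{1}(invgK b) aK.
Qed.

Lemma finite_index_setI {G : groupType} {M N : groupClosed G} :
  finite_index M -> finite_index N ->
  exists K : groupClosed G,
    finite_index K /\ forall x, (x \in K) = (x \in M) && (x \in N).
Proof.
move=> Mfi Nfi; have idM : {in M &, {morph id : x y / x * y}} by [].
by exists (morph_preim idM N); split; [exact: finite_index_preim|].
Qed.

Theorem Comm_contains_virtual_action {B G : groupType} {M : groupClosed G}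
    {act : B -> G -> G} :
  virtual_action M act -> virtually_faithful M act ->
  contains_copy_of B (Comm G).
Proof.
move=> va vf; have [Mfi aM aH a1 aC] := va.
pose pa b := PartialAuto Mfi Mfi (virtual_action_iso b va).
pose F b : Comm G := \pi_(Comm G) (pa b).
have FM b c : F (b * c) = F b * F c.
  rewrite [RHS](Comm_mulE (pa b) (pa c)).
  apply/CommP/agree_fi_dom => x /= xM; last exact: aC.
  by rewrite (pa_dom_comp (pa b) (pa c)) xM aM.
have F1 : F 1 = 1 by apply/CommP; apply: agree_fi_dom.
have FV b : F b^-1 = (F b)^-1.
  by apply: (mulgI (F b)); rewrite -FM !mulgV.
have F_eq1 b : F b = 1 -> b = 1.
  move=> Fb1; apply/eqP; apply/negPn/negP => bN1.
  have /CommP[N [Nfi NM _ e]] : F b = \pi_(Comm G) (pa_id G) by exact: Fb1.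
  have [x [xM xN /negP[]]] := vf b N bN1 Nfi.
  by apply/eqP; exact: e.
have imF : group_closed [pred c | `[< exists b, F b = c >]].
  split; first by apply/asboolP; exists 1.
  move=> _ _ /asboolP[b <-] /asboolP[c <-]; apply/asboolP.
  by exists (b * c^-1); rewrite FM FV.
exists (mk_subgroup imF), F; split; first by move=> x y _ _; exact: FM.
split.
- by move=> b _; apply/asboolP; exists b.
- move=> b c _ _ Fbc; apply/eqP; rewrite -[_ == _](can_eq (mulgK c^-1)) mulgV.
  by apply/eqP/F_eq1; rewrite FM FV Fbc mulgV.
- by move=> c /asboolP[b <-]; exists b.
Qed.

(** An action on [K] need not preserve [L], but the elements of [K] whose whole
orbit lies in [L] form an invariant subgroup; it has finite index because the
acting group, enumerated by [s], is finite. *)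
Lemma virtual_action_core {B A : groupType} {K L : groupClosed A}
    {act : B -> A -> A} (s : seq B) :
  virtual_action K act -> finite_index L -> (forall b, b \in s) ->
  exists M : groupClosed A,
    [/\ {subset M <= K}, {subset M <= L} & virtual_action M act].
Proof.
move=> [Kfi aK aH a1 aC] Lfi sB.
have [M [Mfi MP]] : exists M : groupClosed A, finite_index M /\
    forall x, (x \in M) = (x \in K) && all (fun b => act b x \in L) s.
  elim: s {sB} => [|b s [M [Mfi MP]]].
    by exists K; split=> // x; rewrite andbT.
  have [N [Nfi NP]] :=
    finite_index_setI (finite_index_preim (aH b) Kfi Lfi) Mfi.
  exists N; split=> // x; rewrite NP MP morph_preimP /=.
  by case: (x \in K).
have MK : {subset M <= K} by move=> x; rewrite MP => /andP[].
exists M; split=> //.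
- move=> x; rewrite MP => /andP[xK /allP/(_ _ (sB 1))].
  by rewrite a1.
- split=> //.
  + move=> b x xM; move: (xM); rewrite !MP => /andP[xK /allP xL].
    rewrite aK //=; apply/allP=> c _.
    by rewrite -[act c _]/((act c \o act b) x) -aC // xL.
  + by move=> b x y /MK xK /MK yK; exact: aH.
  + by move=> x /MK; exact: a1.
  + by move=> b c x /MK; exact: aC.
Qed.

(** With [f] an isomorphism from [H <= G] onto [L <= A], an action on an
invariant subgroup of [L] is conjugated by [f]; finiteness of [B] serves to
find such a subgroup. *)
Lemma virtual_action_transport {B G A : groupType} {K : groupClosed A}
    {act : B -> A -> A} (s : seq B) :
  abstractly_commensurable G A -> (forall b, b \in s) ->
  virtual_action K act -> virtually_faithful K act ->
  exists (M : groupClosed G) (act' : B -> G -> G),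
    virtual_action M act' /\ virtually_faithful M act'.
Proof.
move=> [H [L [Hfi Lfi [f fI]]]] sB vaK vf.
have [M [MK ML vaM]] := virtual_action_core s vaK Lfi sB.
have [Mfi aM aH a1 aC] := vaM.
have [fM [fL f_inj f_surj]] := fI.
have [gM [gH g_inj g_surj]] := subgroup_iso_inv fI.
set g := 'pinv_(_) _ _ in gM gH g_inj g_surj.
have fK x : x \in H -> g (f x) = x.
  by move=> xH; apply: pinvKV; [exact: f_inj|rewrite inE].
have gK y : y \in L -> f (g y) = y.
  by move=> /f_surj[x xH <-]; rewrite fK.
have gHL y : y \in L -> g y \in H by exact: gH.
exists (morph_preim fM M), (fun b x => g (act b (f x))); split.
  split; first exact: finite_index_preim.
  - move=> b x /andP[xH xM]; apply/andP; split; first by apply/gHL/ML/aM.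
    by rewrite gK ?aM //; apply/ML/aM.
  - move=> b x y /andP[xH xM] /andP[yH yM].
    by rewrite fM // aH // gM //; apply/ML/aM.
  - by move=> x /andP[xH xM]; rewrite a1 // fK.
  - move=> b c x /andP[xH xM]; rewrite /comp gK; last by apply/ML/aM.
    by rewrite aC.
move=> b N bN1 Nfi.
have [P [Pfi PP]] := finite_index_setI (finite_index_preim gM Lfi Nfi) Mfi.
have [x [xK]] := vf b P bN1 Pfi.
rewrite PP morph_preimP => /andP[/andP[xL gxN] xM] ax.
exists (g x); split=> //; first by apply/andP; rewrite gHL //= gK.
rewrite gK //; apply: contraNneq ax => /(congr1 f).
by rewrite !gK //; [move->|apply/ML/aM].
Qed.

(** By the pigeonhole principle two powers of [x] lie in the same coset. *)
Lemma finite_index_power {G : groupType} {N : groupClosed G} (x : G) :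
  finite_index N -> exists2 m, 0 < m & x ^+ m \in N.
Proof.
move=> Nfi; apply: contrapT => noN.
have inj : injective (fun m => left_coset N (x ^+ m)).
  move=> i j; wlog lij : i j / i <= j.
    by move=> W e; case/orP: (leq_total i j) => le; [|apply: esym]; apply: W.
  move=> /left_coset_eq; rewrite -{1}(subnKC lij) expgnDr mulKg => xN.
  case: (posnP (j - i)) => [/eqP|ij]; last by case: noN; exists (j - i).
  by rewrite subn_eq0 => lji; apply/eqP; rewrite eqn_leq lij.
apply: infinite_nat; apply: sub_finite_set (finite_preimage _ Nfi).
  by move=> m _; exists (x ^+ m).
by move=> i j _ _; exact: inj.
Qed.

Lemma virtually_abelian_commensurable {G A : groupType} :
  abstractly_commensurable G A -> (forall x y : A, commute x y) ->
  virtually_abelian G.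
Proof.
move=> [H [L [Hfi _ [f [fM [_ f_inj _]]]]]] cA; exists H; split=> // x y xH yH.
by apply: f_inj; rewrite ?inE //= ?gpredM // !fM // cA.
Qed.

End VirtualActions.

(** * Exponent sums of words *)

Section ExponentSum.
Local Open Scope ring_scope.
Import GRing.Theory.
Context {T : choiceType}.

Definition exponent_sum (y : T) (w : word T) : int :=
  \sum_(a <- w | a.1 == y) (-1) ^+ a.2.

Lemma exponent_sum_cat y w1 w2 :
  exponent_sum y (w1 ++ w2) = exponent_sum y w1 + exponent_sum y w2.
Proof. exact: big_cat. Qed.

Lemma exponent_sum_cons y a w :
  exponent_sum y (a :: w) = exponent_sum y [:: a] + exponent_sum y w.
Proof. exact: (exponent_sum_cat y [:: a]). Qed.

Lemma exponent_sum1 y x b :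
  exponent_sum y [:: (x, b)] = if x == y then (-1) ^+ b else 0.
Proof.
by rewrite /exponent_sum big_cons big_nil /=; case: ifP; rewrite ?addr0.
Qed.

Lemma exponent_sum_cancel y x b :
  exponent_sum y [:: (x, b)] + exponent_sum y [:: (x, ~~ b)] = 0.
Proof. by rewrite !exponent_sum1; case: ifP => // _; case: b. Qed.

End ExponentSum.

(** * Words in right-angled Artin groups *)

Section RAAG.
Import GRing.Theory.
Context {V : finType} {e : rel V}.
Local Open Scope quotient_scope.

Local Notation A := (raag e).
Local Notation raag_eq :=
  (@pres_eq V [set r | exists u v : V, e u v /\ r = word_comm u v]%classic).

Definition raag_of_word (w : word V) : A := \pi_A w.
Local Notation "''[' w ]" := (raag_of_word w) (format "''[' w ]").

Lemma raag_of_word_cat w1 w2 : '[w1 ++ w2] = ('[w1] * '[w2])%g.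
Proof. exact/esym/pres_mulE. Qed.

Lemma raag_of_word_inv w : '[word_inv w] = ('[w]^-1)%g.
Proof. exact/esym/pres_invE. Qed.

Lemma raag_ind (P : A -> Prop) : (forall w, P '[w]) -> forall g, P g.
Proof. by move=> Pw; elim/quotW. Qed.

Lemma raag_of_wordP w1 w2 : raag_eq w1 w2 <-> '[w1] = '[w2].
Proof. exact: presentedP. Qed.

Lemma raag_letterV x b : '[[:: (x, ~~ b)]] = ('[[:: (x, b)]]^-1)%g.
Proof. by rewrite -raag_of_word_inv. Qed.

Lemma raag_letter_commute x y b c :
  e x y -> commute '[[:: (x, b)]] '[[:: (y, c)]].
Proof.
move=> exy.
have cxy : commute '[[:: (x, false)]] '[[:: (y, false)]].
  have /raag_of_wordP : raag_eq (word_comm x y) [::].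
    by apply: pres_rel; exists x, y.
  rewrite -[word_comm x y]/([:: (x, ~~ false)] ++ [:: (y, ~~ false)] ++
    [:: (x, false)] ++ [:: (y, false)]) !raag_of_word_cat !raag_letterV mulgA.
  rewrite -invgM => /(congr1 (mulg ('[[:: (y, false)]] * '[[:: (x, false)]])%g)).
  by rewrite mulVKg /commute => ->; exact: mulg1.
have cxyc : commute '[[:: (x, false)]] '[[:: (y, c)]].
  by case: c => //; rewrite (raag_letterV y false); exact: commuteV.
case: b => //; rewrite (raag_letterV x false).
by apply/commute_sym/commuteV/commute_sym.
Qed.

Lemma raag_abelian : (forall x y, x != y -> e x y) ->
  forall g h : A, commute g h.
Proof.
move=> ce; have cl x b y c : commute '[[:: (x, b)]] '[[:: (y, c)]].
  have [->|/ce] := eqVneq x y; last exact: raag_letter_commute.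
  case: (eqVneq b c) => [->|]; first exact: commute_refl.
  rewrite eq_sym -[c == b]negbK -addbN addbC.
  by case: b c => [] [] // _; rewrite ?(raag_letterV y false);
     [apply: commute_sym|]; apply: commuteV; exact: commute_refl.
elim/raag_ind=> w1; elim/raag_ind=> w2.
elim: w1 => [|[x b] w1 IH1]; first exact/commute_sym/commute1.
rewrite -cat1s raag_of_word_cat.
apply: commute_sym; apply: commuteM; apply: commute_sym => //.
elim: w2 {w1 IH1} => [|[y c] w2 IH2]; first exact: commute1.
by rewrite -(cat1s (y, c)) raag_of_word_cat; apply: commuteM.
Qed.

(** The twist of a relator is a relator up to replacing generators by their
inverses, which is again trivial because inverses commute as well. *)
Lemma raag_relator_letters x y b c : e x y ->
  raag_eq [:: (x, ~~ b); (y, ~~ c); (x, b); (y, c)] [::].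
Proof.
move=> exy; apply/raag_of_wordP.
rewrite -[X in '[X] = _]/([:: (x, ~~ b)] ++ [:: (y, ~~ c)] ++
  [:: (x, b)] ++ [:: (y, c)]) !raag_of_word_cat.
by rewrite (raag_letter_commute x y b c exy) !raag_letterV mulKg mulVg.
Qed.

Lemma exponent_sum_raag y w1 w2 :
  raag_eq w1 w2 -> exponent_sum y w1 = exponent_sum y w2.
Proof.
elim=> // [||x b|_ [x [z [_ ->]]]].
- by move=> {}w1 w3 {}w2 _ -> _ ->.
- by move=> {}w1 w1' {}w2 w2' _ e1 _ e2; rewrite !exponent_sum_cat e1 e2.
- by rewrite exponent_sum_cons exponent_sum_cancel /exponent_sum big_nil.
- rewrite !(exponent_sum_cons _ _ (_ :: _)) addrA addrACA.
  have := exponent_sum_cancel y x true; have := exponent_sum_cancel y z true.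
  by move=> /= -> ->; rewrite /exponent_sum big_nil.
Qed.

Definition raag_exponent (y : V) (g : A) : int := exponent_sum y (repr g).

Lemma raag_exponentE y w : raag_exponent y '[w] = exponent_sum y w.
Proof. by apply: exponent_sum_raag; exact: pres_eq_repr. Qed.

Lemma raag_exponentM y g h :
  raag_exponent y (g * h)%g = (raag_exponent y g + raag_exponent y h)%R.
Proof.
elim/raag_ind: g => w1; elim/raag_ind: h => w2.
by rewrite -raag_of_word_cat !raag_exponentE exponent_sum_cat.
Qed.

(** * Twisting the letters [v] according to the height of their prefix *)

Section Twist.
(* The modulus is [n.+2] because ['Z_0] and ['Z_1] are both Z/2. *)
Context (n : nat) (u v : V).
Local Open Scope ring_scope.

Definition height (w : word V) : 'Z_n.+2 := (exponent_sum u w)%:~R.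

(** Here [i] is the height at which the word starts, so that the letter [v] at
a given position is inverted iff [s] holds at [i] plus the height of the prefix
preceding it. *)
Fixpoint twist (s : 'Z_n.+2 -> bool) (i : 'Z_n.+2) (w : word V) : word V :=
  if w is a :: w' then
    (a.1, a.2 (+) ((a.1 == v) && s i)) :: twist s (i + height [:: a]) w'
  else [::].

Lemma height_cat w1 w2 : height (w1 ++ w2) = height w1 + height w2.
Proof. by rewrite /height exponent_sum_cat rmorphD. Qed.

Lemma height_nil : height [::] = 0.
Proof. by rewrite /height /exponent_sum big_nil. Qed.

Lemma height_cons a w : height (a :: w) = height [:: a] + height w.
Proof. exact: (height_cat [:: a]). Qed.

Lemma height_letter x b : x != u -> height [:: (x, b)] = 0.
Proof. by move=> /negPf xu; rewrite /height exponent_sum1 xu. Qed.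

Lemma height_raag w1 w2 : raag_eq w1 w2 -> height w1 = height w2.
Proof. by move=> e12; rewrite /height (exponent_sum_raag u _ _ e12). Qed.

Lemma twist_cat s i w1 w2 :
  twist s i (w1 ++ w2) = twist s i w1 ++ twist s (i + height w1) w2.
Proof.
elim: w1 i => [|a w1 IH] i /=; first by rewrite height_nil addr0.
by rewrite IH (height_cons a w1) addrA.
Qed.

Lemma twist_id s i w : v \notin map fst w -> twist s i w = w.
Proof.
elim: w i => //= -[x b] w IH i; rewrite inE negb_or eq_sym => /andP[/negPf xv vw].
by rewrite /= xv addbF IH.
Qed.

Lemma twist_false i w : twist (fun=> false) i w = w.
Proof. by elim: w i => //= -[x b] w IH i; rewrite andbF addbF IH. Qed.

Lemma eq_twist s t i w : s =1 t -> twist s i w = twist t i w.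
Proof. by move=> st; elim: w i => //= a w IH i; rewrite st IH. Qed.

Hypothesis vu : v != u.

Lemma height_flip a c :
  height [:: (a.1, a.2 (+) ((a.1 == v) && c))] = height [:: a].
Proof.
case: a => x b /=; have [->|_] := eqVneq x v; last by rewrite addbF.
by rewrite !height_letter.
Qed.

(** Inverting letters [v] does not affect the exponent sum of [u]; this is why
twists preserve the kernel of the height and compose at all. *)
Lemma height_twist s i w : height (twist s i w) = height w.
Proof.
elim: w i => //= a w IH i.
by rewrite height_cons IH height_flip -height_cons.
Qed.

Lemma twist_comp s t i w :
  twist s i (twist t i w) = twist (fun c => s c (+) t c) i w.
Proof.
elim: w i => //= a w IH i; rewrite height_flip IH /=; congr ((_, _) :: _).
by case: (a.1 == v); rewrite /= ?addbF // -addbA [t i (+) _]addbC.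
Qed.

Hypotheses (e_uv : ~~ e u v) (e_vu : ~~ e v u).

(** A relator [x^-1 y^-1 x y] without [v] is unchanged.  If it contains [v], then
it does not contain [u], so the height stays [i] along the relator and all the
occurrences of [v] are treated alike. *)
Lemma twist_relator s i x y :
  e x y -> raag_eq (twist s i (word_comm x y)) [::].
Proof.
move=> exy; have [vxy|] := boolP (v \in [:: x; y]); last first.
  rewrite !inE !negb_or => /andP[vx vy]; rewrite twist_id.
    by apply: pres_rel; exists x, y.
  by rewrite /= !inE !negb_or vx vy.
have [xu yu] : x != u /\ y != u.
  (* If [x] or [y] is [u], the other one is adjacent to [u], hence is not [v]. *)
  split; apply: contraTneq vxy => E; move: exy; rewrite E !inE => exy.
    rewrite negb_or vu; apply: contraNneq e_uv => ->; exact: exy.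
  rewrite negb_or vu andbT; apply: contraNneq e_vu => ->; exact: exy.
rewrite /= !height_letter // !addr0.
exact: raag_relator_letters.
Qed.

Lemma twist_raag s i w1 w2 :
  raag_eq w1 w2 -> raag_eq (twist s i w1) (twist s i w2).
Proof.
move=> e12; elim: e12 i => {w1 w2} [w|w1 w2 _ IH|w2 w1 w3 _ IH1 _ IH2
  |w1 w1' w2 w2' e1 IH1 _ IH2|x b|_ [x [y [exy ->]]]] i.
- exact: pres_refl.
- exact: pres_sym.
- exact: pres_trans (IH1 i) (IH2 i).
- by rewrite !twist_cat (height_raag _ _ e1); apply: pres_cat.
- rewrite /=; have [->|_] := eqVneq x v; last by rewrite !addbF; exact: pres_cancel.
  by rewrite height_letter // addr0 addNb; exact: pres_cancel.
- exact: twist_relator.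
Qed.

Definition raag_twist s (i : 'Z_n.+2) (g : A) : A := '[twist s i (repr g)].

Lemma raag_twistE s i w : raag_twist s i '[w] = '[twist s i w].
Proof. by apply/raag_of_wordP/twist_raag; exact: pres_eq_repr. Qed.

Definition raag_height (g : A) : 'Z_n.+2 := height (repr g).

Lemma raag_heightE w : raag_height '[w] = height w.
Proof. by apply: height_raag; exact: pres_eq_repr. Qed.

Lemma raag_heightM g h :
  raag_height (g * h)%g = raag_height g + raag_height h.
Proof.
elim/raag_ind: g => w1; elim/raag_ind: h => w2.
by rewrite -raag_of_word_cat !raag_heightE height_cat.
Qed.

Lemma raag_height1 : raag_height 1%g = 0.
Proof. by rewrite -height_nil -raag_heightE. Qed.

Lemma raag_heightV g : raag_height g^-1%g = - raag_height g.
Proof.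
by apply: (addrI (raag_height g)); rewrite -raag_heightM mulgV subrr raag_height1.
Qed.

(** A twist is a crossed homomorphism for the height; on elements of height 0
the shift disappears. *)
Lemma raag_twistM s i g h :
  raag_twist s i (g * h)%g =
  (raag_twist s i g * raag_twist s (i + raag_height g)%R h)%g.
Proof.
elim/raag_ind: g => w1; elim/raag_ind: h => w2.
by rewrite -raag_of_word_cat raag_heightE !raag_twistE twist_cat raag_of_word_cat.
Qed.

Fact height0_closed : group_closed [pred g | raag_height g == 0].
Proof.
split; first by rewrite inE raag_height1.
move=> g h /= /eqP g0 /eqP h0.
by rewrite inE raag_heightM raag_heightV g0 h0 subr0.
Qed.

Definition height0 : groupClosed A := mk_subgroup height0_closed.

Lemma height0P g : reflect (raag_height g = 0) (g \in height0).
Proof. exact: eqP. Qed.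

Lemma finite_index_height0 : finite_index height0.
Proof.
apply: (finite_index_inv (c := raag_height)); first exact: finite_finset.
move=> g h E; apply/height0P.
by rewrite raag_heightM raag_heightV E addNr.
Qed.

(** The set of residues at which [f] has a nonzero coordinate; multiplication in
[Z2_pow], written multiplicatively, becomes symmetric difference. *)
Definition sign_flips (f : Z2_pow n.+2) (c : 'Z_n.+2) : bool := f c != 1%g.

Definition sign_act (f : Z2_pow n.+2) (g : A) : A :=
  raag_twist (sign_flips f) 0 g.

Lemma sign_flips1 : sign_flips 1%g =1 fun=> false.
Proof. by move=> c; rewrite /sign_flips ffunE eqxx. Qed.

Lemma sign_flipsM f g :
  sign_flips (f * g)%g =1 fun c => sign_flips f c (+) sign_flips g c.
Proof.
move=> c; rewrite /sign_flips ffunE.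
by move: (f c) (g c) => [[|[|//]] ?] [[|[|//]] ?].
Qed.

Lemma sign_act_virtual : virtual_action height0 sign_act.
Proof.
split.
- exact: finite_index_height0.
- move=> f; elim/raag_ind=> w /height0P w0; apply/height0P; rewrite -[RHS]w0.
  by rewrite /sign_act raag_twistE !raag_heightE height_twist.
- move=> f g h /height0P g0 _.
  by rewrite /sign_act raag_twistM g0 addr0.
- elim/raag_ind=> w _; rewrite /sign_act raag_twistE.
  by rewrite (eq_twist _ _ _ _ sign_flips1) twist_false.
- move=> f g; elim/raag_ind=> w _; rewrite /comp /sign_act !raag_twistE.
  by rewrite twist_comp (eq_twist _ _ _ _ (sign_flipsM f g)).
Qed.

(** The word [u^j v u^-j], or [u^j v^-1 u^-j] if [b] holds: a generator of the
kernel of the height, whose only letter [v] sits at height [j]. *)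
Definition conj_word (j : 'Z_n.+2) (b : bool) : word V :=
  nseq j (u, false) ++ [:: (v, b)] ++ nseq j (u, true).

Lemma height_nseq j b : height (nseq j (u, b)) = (-1) ^+ b * j%:R.
Proof.
elim: j => [|j IH]; first by rewrite height_nil mulr0.
rewrite /= height_cons IH /height exponent_sum1 eqxx rmorphXn rmorphN1.
by rewrite -natr1 mulrDr mulr1 addrC.
Qed.

Lemma height_conj_word j b : height (conj_word j b) = 0.
Proof.
rewrite /conj_word !height_cat !height_nseq height_letter //.
by rewrite add0r mul1r mulN1r subrr.
Qed.

Lemma twist_conj_word s j b :
  twist s 0 (conj_word j b) = conj_word j (b (+) s j).
Proof.
have notv k (c : bool) : v \notin map fst (nseq k (u, c)).
  by rewrite map_nseq mem_nseq (negPf vu) andbF.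
rewrite /conj_word !twist_cat !(twist_id _ _ _ (notv _ _)) height_nseq /= eqxx.
by rewrite add0r mul1r natr_Zp.
Qed.

Lemma conj_wordV j b : '[conj_word j (~~ b)] = ('[conj_word j b]^-1)%g.
Proof.
rewrite -raag_of_word_inv; congr raag_of_word.
rewrite /conj_word !word_inv_cat -catA.
have nI k c : word_inv (nseq k (u, c)) = nseq k (u, ~~ c).
  by rewrite /word_inv map_nseq rev_nseq.
by rewrite !nI.
Qed.

Lemma raag_exponent_conj_wordX j m :
  raag_exponent v ('[conj_word j false] ^+ m)%g = m.
Proof.
have e1 : raag_exponent v '[conj_word j false] = 1.
  have nz k c : exponent_sum v (nseq k (u, c)) = 0.
    elim: k => [|k IH]; first by rewrite /exponent_sum big_nil.
    by rewrite /= exponent_sum_cons IH exponent_sum1 eq_sym (negPf vu).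
  by rewrite raag_exponentE !exponent_sum_cat !nz exponent_sum1 eqxx.
elim: m => [|m IH]; first by rewrite (raag_exponentE v [::]) /exponent_sum big_nil.
by rewrite expgS raag_exponentM e1 IH.
Qed.

(** If [f] flips at [j], then [sign_act f] inverts [k = u^j v u^-j], so it moves
every positive power of [k]: otherwise [k ^+ m] would equal its inverse, while
the exponent sum of [v] in [k ^+ m * k ^+ m] is [2 m]. *)
Lemma sign_act_faithful : virtually_faithful height0 sign_act.
Proof.
move=> f N fN1 Nfi.
have [j fj] : exists j, f j != 1%g.
  apply/existsP; apply: contraNT fN1; rewrite negb_exists => /forallP f1.
  by apply/eqP/ffunP => j; rewrite ffunE; apply/eqP; rewrite -[_ == _]negbK.
set k := '[conj_word j false].
have kK : k \in height0 by apply/height0P; rewrite raag_heightE height_conj_word.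
have [m m_gt0 kmN] := finite_index_power k Nfi.
exists (k ^+ m)%g; split=> //; first exact: gpredXn.
have [_ _ aH _ _] := sign_act_virtual.
have ak : sign_act f k = k^-1%g.
  rewrite /sign_act raag_twistE twist_conj_word /sign_flips fj.
  exact: (conj_wordV j false).
have -> : sign_act f (k ^+ m)%g = (k ^- m)%g.
  elim: m {m_gt0 kmN} => [|m IH].
    by rewrite expg0 invg1; exact: (morph_in1 (aH f)).
  by rewrite {1}expgS (aH f) ?gpredXn // IH ak -invgM -expgSr.
apply/eqP => E; have : raag_exponent v (k ^+ m * k ^+ m)%g = 0.
  by rewrite -{1}E mulVg -(expg0 k) raag_exponent_conj_wordX.
rewrite raag_exponentM !raag_exponent_conj_wordX => /eqP.
by rewrite -PoszD eqz_nat addnn double_eq0 eqn0Ngt m_gt0.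
Qed.

End Twist.
End RAAG.

(** * Right-angled Artin groups and commensurators *)

Theorem mainTheorem2 (G : groupType)
  (hG : ~ virtually_abelian G)
  (hComm : ~ (forall n : nat, exists k : nat,
     n <= k /\ contains_copy_of (Z2_pow k) (Comm G)))
  (V : finType) (e : rel V) (e_sym : symmetric e) (e_irr : irreflexive e) :
  ~ abstractly_commensurable G (raag e).
Proof.
move=> GA; case: (pselect (forall x y, x != y -> e x y)) => [ce|].
  exact/hG/(virtually_abelian_commensurable GA)/raag_abelian.
move=> /existsNP[u /existsNP[v /not_implyP[uv /negP e_uv]]].
apply: hComm => n; exists n.+2; split; first by rewrite -addn2 leq_addr.
have vu : v != u by rewrite eq_sym.
have e_vu : ~~ e v u by rewrite e_sym.
have [M [act [va vf]]] := virtual_action_transport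
  (enum {ffun 'I_n.+2 -> 'Z_2}) GA (mem_enum _)
  (sign_act_virtual n u v vu e_uv e_vu) (sign_act_faithful n u v vu e_uv e_vu).
exact: Comm_contains_virtual_action va vf.
Qed.
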